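(* Let $n \ge 1$ and let $(S, S')$ be a pair of measurable subsets of the sphere $S^{n}$ such that $st_S = st_{S'}$. Let $\overline S = S^n \setminus S$ and $\overline{S'} = S^n \setminus S'$ be their complementary subsets. Then $st_{\overline S} = st_{\overline{S'}}$ and $st_{S, \overline S} = st_{S', \overline{S'}}$.
   Context: $S^n \subset \mathbb{R}^{n+1}$ is the sphere of unit radius, $\mu$ is its $n$-dimensional surface measure, and $d_E$ is the Euclidean distance of $\mathbb{R}^{n+1}$ restricted to $S^n$. $H$ is the Heaviside function, $H(x)=1$ for $x>0$ and $H(x)=0$ otherwise. For measurable sets $A, B \subset S^n$, the cumulative measure function of distance between points of $A$ is $St_A(\ell) = \int_A d\mu(x) \int_A d\mu(y)\, H(\ell - d_E(x,y))$, and the cumulative measure function of distance between a point in $A$ and a point in $B$ is $St_{A,B}(\ell) = \int_A d\mu(x) \int_B d\mu(y)\, H(\ell - d_E(x,y))$. The measure density functions of distance $st_A$ and $st_{A,B}$ are the derivatives with respect to $\ell$ of $St_A$ and $St_{A,B}$ respectively. They are understood as densities on the line of distances (defined almost everywhere), so that equality of two measure density functions is equivalent to equality of the corresponding cumulative functions. These functions are not normalized: the total mass of $st_A$ is $\mu(A)^2$. *)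

(* Defs.v *)
From HB Require Import structures.
From mathcomp Require Import all_boot all_order all_algebra.
From mathcomp Require Import all_classical all_reals all_analysis.
From mathcomp Require Import measurable_realfun.

Set Implicit Arguments.
Unset Strict Implicit.
Unset Printing Implicit Defensive.

Import Order.TTheory GRing.Theory Num.Theory.
Import numFieldNormedType.Exports.

Local Open Scope classical_set_scope.
Local Open Scope ring_scope.

(* R^m is represented by m.-tuple R, with its product (Borel) sigma-algebra. *)

Section lebesgue_tuple_succ.
Context {R : realType}.

Definition cons_tuple m (p : measurableTypeR R * m.-tuple R) :
  m.+1.-tuple R := [tuple of p.1 :: p.2].

Lemma measurable_cons_tuple m : measurable_fun [set: _] (@cons_tuple m).
Proof.
exact: (@measurable_cons _ _ _ (R : measurableType _) fst _ snd
  measurable_fst measurable_snd).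
Qed.

Context {m : nat} (mu : {sigma_finite_measure set (m.-tuple R) -> \bar R}).

Definition lebesgue_tuple_succ : set (m.+1.-tuple R) -> \bar R :=
  pushforward (lebesgue_measure \x mu)%E (@cons_tuple m).

Let succ0 : lebesgue_tuple_succ set0 = 0%E.
Proof. by rewrite /lebesgue_tuple_succ /pushforward preimage_set0 measure0. Qed.

Let succ_ge0 A : (0 <= lebesgue_tuple_succ A)%E.
Proof. by apply: (measure_ge0 (lebesgue_measure \x mu)%E). Qed.

Let succ_sigma_additive : semi_sigma_additive lebesgue_tuple_succ.
Proof.
apply: measure_semi_sigma_additive.
exact: measurable_cons_tuple.
Qed.

HB.instance Definition _ := isMeasure.Build _ _ _ lebesgue_tuple_succ
  succ0 succ_ge0 succ_sigma_additive.

Let succ_sigma_finite : sigma_finite setT lebesgue_tuple_succ.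
Proof.
pose un (x : m.+1.-tuple R) : measurableTypeR R * m.-tuple R :=
  (thead x, [tuple of behead x]).
have consK p : un (cons_tuple p) = p.
  by case: p => a b; rewrite /un /= theadE; congr pair; apply: val_inj.
have mun : measurable_fun setT un.
  apply: measurable_fun_pair; last exact: measurable_behead.
  exact: (@measurable_tnth _ (R : measurableType _)).
have /sigma_finiteP[F [FT ndF Foo]] := sigma_finiteT (@lebesgue_measure R).
have /sigma_finiteP[G [GT ndG Goo]] := sigma_finiteT mu.
exists (fun k => un @^-1` (F k `*` G k)).
  rewrite -preimage_bigcup; apply/esym/seteqP; split => // x _.
  have [i _ Fi] : (\bigcup_k F k) (un x).1 by rewrite -FT.
  have [j _ Gj] : (\bigcup_k G k) (un x).2 by rewrite -GT.
  exists (maxn i j) => //; split => /=.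
    by move: Fi; exact/subsetPset/ndF/leq_maxl.
  by move: Gj; exact/subsetPset/ndG/leq_maxr.
move=> k; have [mF Fk] := Foo k; have [mG Gk] := Goo k.
split; first by rewrite -[X in measurable X]setTI; apply: mun => //; exact: measurableX.
rewrite /lebesgue_tuple_succ /pushforward -comp_preimage.
rewrite (_ : un \o _ = id); last by apply/funext => p /=; rewrite consK.
by rewrite preimage_id product_measure1E// lte_mul_pinfty// ge0_fin_numE.
Qed.

HB.instance Definition _ := Measure_isSigmaFinite.Build _ _ _
  lebesgue_tuple_succ succ_sigma_finite.

End lebesgue_tuple_succ.

(* Lebesgue measure on R^m: a unit mass on the one-point space R^0, and the
   product measure on R^(k+1) = R x R^k. *)
Fixpoint lebesgue_tuple {R : realType} (m : nat) :
    {sigma_finite_measure set (m.-tuple R) -> \bar R} :=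
  match m with
  | 0 => \d_([tuple] : 0.-tuple R)
  | k.+1 => lebesgue_tuple_succ (lebesgue_tuple k)
  end.

Section sphere.
Context {R : realType}.

Definition enorm m (x : m.-tuple R) : R :=
  Num.sqrt (\sum_(i < m) tnth x i ^+ 2).

Definition edist m (x y : m.-tuple R) : R :=
  Num.sqrt (\sum_(i < m) (tnth x i - tnth y i) ^+ 2).

Definition unit_sphere n : set (n.+1.-tuple R) := [set x | enorm x = 1].
Arguments unit_sphere n : clear implicits.

Definition normalize m (x : m.-tuple R) : m.-tuple R :=
  [tuple tnth x i / enorm x | i < m].

Definition punctured_ball m : set (m.-tuple R) := [set x | 0 < enorm x <= 1].

Lemma measurable_enorm m : measurable_fun setT (@enorm m).
Proof.
rewrite (_ : @enorm m = (@powR R)^~ 2^-1 \o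
    (fun x => \sum_(i < m) tnth x i ^+ 2)); last first.
  by apply/funext => x /=; rewrite powR12_sqrt// sumr_ge0// => i _; exact: sqr_ge0.
apply: measurableT_comp; first exact: measurable_powR.
apply: measurable_sum => i; apply: measurable_funX.
exact: (@measurable_tnth _ (R : measurableType _)).
Qed.

Lemma measurable_normalize m : measurable_fun setT (@normalize m).
Proof.
apply/measurable_fun_tnthP => i.
rewrite (_ : _ \o _ = fun x => tnth x i * (enorm x `^ (-1))); last first.
  by apply/funext => x /=; rewrite tnth_mktuple powR_inv1// sqrtr_ge0.
apply: measurable_funM.
  exact: (@measurable_tnth _ (R : measurableType _)).
apply: (@measurableT_comp _ _ _ _ _ _ ((@powR R)^~ (-1)) _ (@enorm m)).
  exact: measurable_powR.
exact: measurable_enorm.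
Qed.

Lemma measurable_punctured_ball m : measurable (@punctured_ball m).
Proof.
have -> : @punctured_ball m = @enorm m @^-1` `]0, 1].
  by apply/seteqP; split => x; rewrite /punctured_ball /= in_itv.
by rewrite -[X in measurable X]setTI; apply: measurable_enorm.
Qed.

(* The cone {t y | 0 < t <= 1, y in A} over a subset A of the sphere. *)
Definition cone m (A : set (m.-tuple R)) : set (m.-tuple R) :=
  @normalize m @^-1` A `&` @punctured_ball m.

(* Surface measure of Borel sets, normalized by integration in polar
   coordinates: Lebesgue(cone A) = \int_0^1 t^n mu(A) dt = mu(A) / (n + 1).
   It is a measure on R^(n+1) carried by the unit sphere. *)
Definition borel_surface_measure n (A : set (n.+1.-tuple R)) : \bar R :=
  (n.+1%:R%:E * lebesgue_tuple n.+1 (cone A))%E.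

Section borel_surface_measure_is_measure.
Context (n : nat).

Let surface0 : @borel_surface_measure n set0 = 0%E.
Proof.
by rewrite /borel_surface_measure /cone preimage_set0 set0I measure0 mule0.
Qed.

Let surface_ge0 A : (0 <= @borel_surface_measure n A)%E.
Proof. by rewrite /borel_surface_measure mule_ge0// lee_fin. Qed.

Let surface_sigma_additive : semi_sigma_additive (@borel_surface_measure n).
Proof.
move=> F mF tF mU; rewrite /borel_surface_measure.
have mN A : measurable A -> measurable (@normalize n.+1 @^-1` A).
  by move=> mA; rewrite -[X in measurable X]setTI; exact: measurable_normalize.
under eq_fun do rewrite -ge0_sume_distrr//.
apply: cvgeZl => //.
have -> : cone (\bigcup_k F k) = \bigcup_k cone (F k).
  by rewrite /cone preimage_bigcup setI_bigcupl.
apply: measure_sigma_additive => [k|].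
  by apply: measurableI; [exact: mN|exact: measurable_punctured_ball].
apply/trivIsetP => i j _ _ ij; rewrite /cone setIACA -preimage_setI.
by move/trivIsetP : tF => /(_ i j Logic.I Logic.I ij) ->; rewrite preimage_set0 set0I.
Qed.

HB.instance Definition _ := isMeasure.Build _ _ _ (@borel_surface_measure n)
  surface0 surface_ge0 surface_sigma_additive.

End borel_surface_measure_is_measure.

(* The surface measure is the completion of the previous one; its domain is the
   sigma-algebra of the Caratheodory-measurable sets. *)
Definition surface_measure n :=
  @completed_measure_extension _ _ R (@borel_surface_measure n).
Arguments surface_measure n : clear implicits.

HB.instance Definition _ n := Measure.on (surface_measure n).

Definition sphere_measurable n (A : set (n.+1.-tuple R)) : Prop :=
  A `<=` unit_sphere n /\
  ((@borel_surface_measure n)^*)%mu.-cara.-measurable A.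

Definition heaviside (x : R) : R := if 0 < x then 1 else 0.

Definition St2 n (A B : set (n.+1.-tuple R)) (l : R) : R :=
  \int[surface_measure n]_(x in A) \int[surface_measure n]_(y in B)
    heaviside (l - edist x y).

Definition St n (A : set (n.+1.-tuple R)) (l : R) : R := St2 A A l.

Definition st2 n (A B : set (n.+1.-tuple R)) : R -> R := derive1 (St2 A B).

Definition st n (A : set (n.+1.-tuple R)) : R -> R := derive1 (St A).

End sphere.
Arguments unit_sphere {R} n _.
Arguments surface_measure {R} n _.

(* Densities on the line of distances are identified when they are equal
   Lebesgue-almost everywhere. For 1 <= n the functions St2 A B vanish on the
   negative axis and are absolutely continuous, so that this is equivalent to
   the equality of the cumulative functions; the points where the derivative
   does not exist, at which derive1 is arbitrary, are negligible. *)
Definition density_eq {R : realType} (f g : R -> R) : Prop :=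
  {ae lebesgue_measure, forall l, f l = g l}.

(* Main.v *)
Require Import Defs.
From HB Require Import structures.
From mathcomp Require Import all_boot all_order all_algebra.
From mathcomp Require Import all_classical all_reals all_analysis.
From mathcomp Require Import measurable_realfun ring lra.

Set Implicit Arguments.
Unset Strict Implicit.
Unset Printing Implicit Defensive.

Import Order.TTheory GRing.Theory Num.Theory.
Import numFieldNormedType.Exports.

Local Open Scope classical_set_scope.
Local Open Scope ring_scope.
Import Defs.

(** Write [mu] for the surface measure, [P A B] for the law of the distance
    between a point of [A] and a point of [B], a measure on the line whose
    distribution function is [St2 A B], and [V] for the law of the distance to
    a fixed point of the sphere, which by rotation invariance does not depend on
    that point. By Fubini [P A setT] is [mu A] times [V] ([distance_mass_setT]), so
    that, [P] being additive and symmetric,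

      [P S (~` S)      = mu S * V - P S S]
      [P (~` S) (~` S) = mu (~` S) * V - P S (~` S)].

    Thus the cumulative functions on the left are determined by [P S S] and by
    [mu S], and the latter by the total mass [mu S ^+ 2] of [P S S].

    The hypothesis however only bears on the derivatives of the cumulative
    functions. That these determine [P S S] rests on absolute continuity: [V]
    does not charge Lebesgue-null sets ([surface_edist_pole_null]), hence
    neither does [P S S], which is at most [mu S * V], and a measure
    dominated by Lebesgue measure is recovered from the derivative of its
    distribution function ([eq_dominated_measure]).

    Rotation invariance is proved from the product structure of Lebesgue
    measure: a plane rotation is a product of three shears, each of which
    preserves volume by Fubini and translation invariance. Finally,
    the sets are measurable for the completed surface measure; they are
    replaced by Borel sets that differ from them by null sets, for which Fubini
    applies ([St2_distance_mass]). *)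

(** * Lebesgue measure on the line *)

Section real_line.
Context {R : realType}.
Notation leb := (@lebesgue_measure R).

Lemma lebesgue_measure_shift (a : R) (A : set R) : measurable A ->
  leb ((fun x => x + a) @^-1` A) = leb A.
Proof.
have mD : measurable_fun setT (fun x : measurableTypeR R => x + a : measurableTypeR R).
  exact: measurable_funD.
move=> mA; rewrite -[LHS]/(pushforward leb
  (fun x : measurableTypeR R => x + a : measurableTypeR R) A).
apply/esym/lebesgue_measure_unique => //= _ [[x y]] _ <-.
rewrite /pushforward (_ : _ @^-1` _ = `]x - a, y - a]%classic); last first.
  by apply/seteqP; split => z /=; rewrite !in_itv/= ltrBlDr lerBrDr.
by rewrite !lebesgue_measure_itv/= !lte_fin ltrD2r -!EFinD opprD addrACA subrr addr0.
Qed.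

(** The preimage in [D] of an interval of length [e] has diameter at most
    [K * e], so [leb (D `&` g @^-1` X)] is at most [2 * K] times the length of
    [X] for intervals [X]; a cover of [N] of small total length is then pulled
    back to one of small total measure. *)
Lemma expanding_preimage_null (D N : set R) (g : R -> R) (K : R) :
  measurable D -> measurable_fun setT g ->
  (forall s t, D s -> D t -> `|s - t| <= K * `|g s - g t|) ->
  measurable N -> leb N = 0%E -> leb (D `&` g @^-1` N) = 0%E.
Proof.
move=> mD mg gK mN N0.
(* A larger constant does no harm. *)
wlog K0 : K gK / 0 < K.
  move=> /(_ (`|K| + 1)); apply; last by rewrite ltr_wpDl.
  move=> s t Ds Dt; apply: (le_trans (gK s t Ds Dt)).
  by rewrite ler_wpM2r// (le_trans (ler_norm K))// lerDl.
have mgN X : measurable X -> measurable (D `&` g @^-1` X).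
  by move=> mX; apply: measurableI => //; rewrite -[X in measurable X]setTI; exact: mg.
have small (X : set R) : ocitv X ->
    (leb (D `&` g @^-1` X) <= (2 * K)%:E * wlength idfun X)%E.
  move=> /ocitvP[->|[[a b] /= ab ->]].
    by rewrite preimage_set0 setI0 measure0 wlength0 mule0.
  rewrite wlength_itv_bnd ?(ltW ab)//=.
  have [->|/set0P[s [Ds gs]]] := eqVneq (D `&` g @^-1` `]a, b]) set0.
    by rewrite measure0 -EFinM lee_fin !mulr_ge0// ltW// subr_gt0.
  have sub : D `&` g @^-1` `]a, b] `<=` `[s - K * (b - a), s + K * (b - a)].
    move=> t [Dt gt]; rewrite /= in_itv/= -ler_distl distrC.
    apply: (le_trans (gK _ _ Ds Dt)); rewrite ler_wpM2l ?ltW//.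
    move: gs gt; rewrite /= !in_itv/= => /andP[? ?] /andP[? ?].
    by rewrite ltr_norml; apply/andP; split; lra.
  apply: (@le_trans _ _ (leb `[s - K * (b - a), s + K * (b - a)])).
    apply: le_measure => //; rewrite inE; last exact: measurable_itv.
    exact: (mgN _ (measurable_itv `]a, b])).
  rewrite lebesgue_measure_itv/= lte_fin; case: ifPn => _.
    by rewrite -EFinD lee_fin; lra.
  by rewrite lee_fin !mulr_ge0// ltW// subr_gt0.
apply/eqP; rewrite eq_le measure_ge0 andbT.
apply/lee_addgt0Pr => e e0; rewrite add0e.
have e2 : 0 < e / (2 * K) by rewrite divr_gt0// mulr_gt0.
have [_ [F [mF NF] <-]] : exists2 x, [set (\sum_(k <oo) wlength idfun (A k))%E
     | A in measurable_cover (N : set (ocitv_type R))] x & (x < (e / (2 * K))%:E)%E.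
  by apply: ereal_inf_lt; rewrite -[ereal_inf _]/(leb N) N0 lte_fin.
move=> sF.
apply: (@le_trans _ _ (leb (\bigcup_k (D `&` g @^-1` (F k))))).
  apply: le_measure; rewrite ?inE.
  - exact: mgN.
  - by apply: bigcupT_measurable => k; apply: mgN; apply: sub_sigma_algebra; exact: mF.
  - by move=> x [Dx /NF[k _ Fk]]; exists k.
have mgF k : measurable (D `&` g @^-1` F k).
  by apply: mgN; apply: sub_sigma_algebra; exact: mF.
apply: (@le_trans _ _ (\sum_(k <oo) leb (D `&` g @^-1` (F k)))%E).
  by apply: measure_sigma_subadditive => //; exact: bigcupT_measurable.
apply: (@le_trans _ _ (\sum_(k <oo) ((2 * K)%:E * wlength idfun (F k)))%E).
  by apply: lee_nneseries => // k _; apply: small; exact: mF.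
rewrite nneseriesZl//.
have K20 : 0 < 2 * K by rewrite mulr_gt0.
by rewrite muleC -lee_pdivlMr//; exact: ltW.
Qed.

(** A finite measure absolutely continuous with respect to Lebesgue measure is
    recovered from the almost everywhere derivative of its distribution
    function: that derivative is the Radon-Nikodym density, by the Lebesgue
    differentiation theorem. Without absolute continuity this fails (a Cantor
    measure has derivative [0] almost everywhere). *)
Lemma eq_dominated_measure (nu1 nu2 : {finite_measure set (measurableTypeR R) -> \bar R}) :
  nu1 `<< leb -> nu2 `<< leb ->
  {ae leb, forall l, derive1 (fun l => fine (nu1 `]-oo, l[%classic)) l =
                     derive1 (fun l => fine (nu2 `]-oo, l[%classic)) l} ->
  forall A, measurable A -> nu1 A = nu2 A.
Proof.
have density (nu : {finite_measure set (measurableTypeR R) -> \bar R}) :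
    nu `<< leb -> exists f : R -> R, [/\ measurable_fun setT f,
    forall A, measurable A -> nu A = (\int[leb]_(x in A) (f x)%:E)%E &
    {ae leb, forall l, derive1 (fun l => fine (nu `]-oo, l[%classic)) l = f l}].
  move=> dom; have [f [f0 ffin fint nuf]] := radon_nikodym_sigma_finite dom.
  pose h : R -> R := fine \o f; have fh : f = EFin \o h by apply/funext => x /=; rewrite fineK.
  rewrite fh in fint nuf.
  have {}fint : leb.-integrable [set: R] (EFin \o h) := fint.
  have mh : measurable_fun [set: R] h by move/integrableP : fint => [/measurable_EFinP].
  exists h; split => //.
  have hint y : leb.-integrable `]-oo, y] (EFin \o h) by exact: integrableS fint.
  have := FTC1Ny hint (open_integrable_locally openT fint).
  have -> : (fun l => fine (nu `]-oo, l[%classic)) =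
      (fun x => (\int[leb]_(t in [set` `]-oo, x]]) h t)%R).
    apply/funext => x; rewrite /Rintegral nuf//; congr fine.
    rewrite -integral_itv_bndo_bndc//.
    by apply/measurable_EFinP; exact: measurable_funS mh.
  by apply: (@filterS _ _ (ae_filter_ringOfSetsType leb)) => x [].
move=> /density[f1 [mf1 nu1f d1]] /density[f2 [mf2 nu2f d2]] d12 A mA.
rewrite nu1f// nu2f//; apply: ae_eq_integral => //.
- by apply/measurable_EFinP; exact: measurable_funS mf1.
- by apply/measurable_EFinP; exact: measurable_funS mf2.
by apply: (@filterS3 _ _ (ae_filter_ringOfSetsType leb)) d1 d2 d12 => x <- <- -> _.
Qed.

End real_line.

(** * Measure-preserving maps of a product *)

Section measure_preserving.
Context {R : realType}.

Definition measure_preserving d (T : measurableType d) (mu : set T -> \bar R)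
    (f : T -> T) :=
  measurable_fun setT f /\ forall A, measurable A -> mu (f @^-1` A) = mu A.

Lemma measure_preserving_comp d (T : measurableType d) (mu : set T -> \bar R)
    (f g : T -> T) :
  measure_preserving mu f -> measure_preserving mu g ->
  measure_preserving mu (f \o g).
Proof.
move=> [mf muf] [mg mug]; split; first exact: measurableT_comp.
move=> A mA; rewrite comp_preimage mug ?muf//.
by rewrite -[X in measurable X]setTI; exact: mf.
Qed.

Context d1 d2 (T1 : measurableType d1) (T2 : measurableType d2).
Variables (m1 : {sigma_finite_measure set T1 -> \bar R})
          (m2 : {sigma_finite_measure set T2 -> \bar R}).

(** Fubini: a map of the product that acts by measure-preserving maps on each
    fibre preserves the product measure. *)
Lemma measure_preserving_snd (f : T1 -> T2 -> T2) :
  measurable_fun setT (fun p => f p.1 p.2) ->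
  (forall x, measure_preserving m2 (f x)) ->
  measure_preserving (m1 \x m2)%E (fun p => (p.1, f p.1 p.2)).
Proof.
move=> mf pf; split; first exact: measurable_fun_pair.
move=> A mA; apply: eq_integral => x _ /=.
rewrite !xsectionE -[RHS](pf x).2//.
by rewrite -xsectionE; exact: measurable_xsection.
Qed.

Lemma product_measure_ysection X : measurable X ->
  (m1 \x m2)%E X = (\int[m2]_y m1 (ysection X y))%E.
Proof.
rewrite -[RHS]/((m1 \x^ m2)%E X).
by apply: product_measure_unique => //= ? ? ? ?; rewrite product_measure2E.
Qed.

Lemma measure_preserving_fst (f : T2 -> T1 -> T1) :
  measurable_fun setT (fun p => f p.2 p.1) ->
  (forall y, measure_preserving m1 (f y)) ->
  measure_preserving (m1 \x m2)%E (fun p => (f p.2 p.1, p.2)).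
Proof.
move=> mf pf.
have mF : measurable_fun setT (fun p : T1 * T2 => (f p.2 p.1, p.2)).
  exact: measurable_fun_pair.
split=> // A mA.
rewrite !product_measure_ysection//; last by rewrite -[X in measurable X]setTI; exact: mF.
apply: eq_integral => y _ /=.
rewrite !ysectionE -[RHS](pf y).2//.
by rewrite -ysectionE; exact: measurable_ysection.
Qed.

End measure_preserving.

(** * Translations, shears and rotations of R^m *)

Section tuples.
Context {R : realType}.

Definition dot m (b y : m.-tuple R) : R := \sum_(i < m) tnth b i * tnth y i.

Definition translate m (b : m.-tuple R) (s : R) (y : m.-tuple R) : m.-tuple R :=
  [tuple tnth y i + s * tnth b i | i < m].

Lemma measurable_dot m (b : m.-tuple R) : measurable_fun setT (dot b).
Proof.
apply: measurable_sum => i; apply: measurable_funM => //.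
exact: (@measurable_tnth _ (R : measurableType _)).
Qed.

Lemma measurable_translate m (b : m.-tuple R) :
  measurable_fun setT (fun p : measurableTypeR R * m.-tuple R => translate b p.1 p.2).
Proof.
apply/measurable_fun_tnthP => i.
rewrite (_ : _ \o _ = fun p => tnth p.2 i + p.1 * tnth b i); last first.
  by apply/funext => x /=; rewrite tnth_mktuple.
apply: measurable_funD.
  apply: (@measurableT_comp _ _ _ _ _ _ (fun x => tnth x i)) => //.
  exact: (@measurable_tnth _ (R : measurableType _)).
by apply: measurable_funM => //; exact: measurable_fst.
Qed.

Definition uncons_tuple m (x : m.+1.-tuple R) : measurableTypeR R * m.-tuple R :=
  (thead x, [tuple of behead x]).

Lemma cons_tupleK m : cancel (@cons_tuple R m) (@uncons_tuple m).
Proof. by case=> a b; rewrite /uncons_tuple /= theadE; congr pair; exact: val_inj. Qed.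

Lemma uncons_tupleK m : cancel (@uncons_tuple m) (@cons_tuple R m).
Proof. by move=> x; rewrite /cons_tuple/= [RHS]tuple_eta; exact: val_inj. Qed.

Lemma tnth_cons0 m (p : measurableTypeR R * m.-tuple R) :
  tnth (cons_tuple p) ord0 = p.1.
Proof. exact: tnth0. Qed.

Lemma tnth_consS m (p : measurableTypeR R * m.-tuple R) (i : 'I_m) :
  tnth (cons_tuple p) (lift ord0 i) = tnth p.2 i.
Proof. exact: tnthS. Qed.

Lemma tnth_uncons m (x : m.+1.-tuple R) (i : 'I_m) :
  tnth (uncons_tuple x).2 i = tnth x (lift ord0 i).
Proof. by rewrite -tnth_consS uncons_tupleK. Qed.

Lemma measurable_uncons_tuple m : measurable_fun setT (@uncons_tuple m).
Proof.
apply: measurable_fun_pair; last exact: measurable_behead.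
exact: (@measurable_tnth _ (R : measurableType _)).
Qed.

Lemma measure_preserving_cons m
    (f : measurableTypeR R * m.-tuple R -> measurableTypeR R * m.-tuple R) :
  measure_preserving (lebesgue_measure \x lebesgue_tuple m)%E f ->
  measure_preserving (lebesgue_tuple m.+1) (@cons_tuple R m \o f \o @uncons_tuple m).
Proof.
move=> [mf pf]; split.
  apply: measurableT_comp; last exact: measurable_uncons_tuple.
  by apply: measurableT_comp => //; exact: measurable_cons_tuple.
move=> A mA; rewrite /= /lebesgue_tuple_succ /pushforward -comp_preimage.
rewrite (_ : _ \o _ = @cons_tuple R m \o f); last first.
  by apply/funext => p /=; rewrite cons_tupleK.
rewrite comp_preimage pf//.
by rewrite -[X in measurable X]setTI; exact: measurable_cons_tuple.
Qed.

Lemma measure_preserving_translate m (b : m.-tuple R) (s : R) :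
  measure_preserving (lebesgue_tuple m) (translate b s).
Proof.
have mtr k (c : k.-tuple R) : measurable_fun setT (translate c s).
  exact: (measurableT_comp (measurable_translate c)
    (pair1_measurable (s : measurableTypeR R))).
elim: m b => [|m IH] b.
  split; first exact: mtr.
  move=> A mA; rewrite (_ : translate b s = id)//.
  (* R^0 has a single point. *)
  by apply/funext => x; rewrite [x]tuple0 [LHS]tuple0.
rewrite (_ : translate b s = @cons_tuple R m \o
   ((fun p => (p.1 + s * tnth b ord0, p.2)) \o
    (fun p => (p.1, translate (uncons_tuple b).2 s p.2))) \o @uncons_tuple m); last first.
  apply/funext => x; apply: eq_from_tnth => i; rewrite tnth_mktuple.
  case: (unliftP ord0 i) => [j ->|->]; last by rewrite tnth_cons0.
  by rewrite tnth_consS tnth_mktuple !tnth_uncons.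
apply/measure_preserving_cons/measure_preserving_comp.
  apply: (@measure_preserving_fst R _ _ (measurableTypeR R) (m.-tuple R)
    lebesgue_measure (lebesgue_tuple m) (fun _ x => x + s * tnth b ord0)) => [|_].
    by apply: measurable_funD => //; exact: measurable_fst.
  split; first exact: measurable_funD.
  by move=> A mA; exact: lebesgue_measure_shift.
apply: (@measure_preserving_snd R _ _ (measurableTypeR R) (m.-tuple R)
  lebesgue_measure (lebesgue_tuple m) (fun _ x => translate (uncons_tuple b).2 s x)) => [|_].
  exact: (measurableT_comp (mtr _ _) measurable_snd).
exact: IH.
Qed.

Definition shear_fst m (k : R) (b : m.-tuple R) (p : measurableTypeR R * m.-tuple R) :
    measurableTypeR R * m.-tuple R :=
  (p.1 - k * dot b p.2, p.2).

Definition shear_snd m (b : m.-tuple R) (p : measurableTypeR R * m.-tuple R) :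
    measurableTypeR R * m.-tuple R :=
  (p.1, translate b p.1 p.2).

Lemma measure_preserving_shear_fst m (k : R) (b : m.-tuple R) :
  measure_preserving (lebesgue_measure \x lebesgue_tuple m)%E (shear_fst k b).
Proof.
apply: (@measure_preserving_fst R _ _ (measurableTypeR R) (m.-tuple R)
  lebesgue_measure (lebesgue_tuple m) (fun y x => x - k * dot b y)) => [|y].
  apply: measurable_funB; first exact: measurable_fst.
  apply: measurable_funM => //.
  exact: (measurableT_comp (measurable_dot b) measurable_snd).
split; first exact: measurable_funB.
by move=> A mA; exact: (lebesgue_measure_shift (- (k * dot b y))).
Qed.

Lemma measure_preserving_shear_snd m (b : m.-tuple R) :
  measure_preserving (lebesgue_measure \x lebesgue_tuple m)%E (shear_snd b).
Proof.
apply: (@measure_preserving_snd R _ _ (measurableTypeR R) (m.-tuple R)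
  lebesgue_measure (lebesgue_tuple m) (fun x y => translate b x y)) => [|x].
  exact: measurable_translate.
exact: measure_preserving_translate.
Qed.

(** For [b] of squared norm [1 - c ^+ 2], with [c] the cosine and [b] the sine
    times a unit vector [u], this is the rotation of the plane spanned by the
    first basis vector and [u], written as the product of three shears; here
    [(1 + c)^-1 *: b] is [tan (theta / 2) *: u]. Shears preserve Lebesgue
    measure by Fubini and translation invariance on the line, so that no change
    of variables formula is needed. *)
Definition rotation m (c : R) (b : m.-tuple R) : m.+1.-tuple R -> m.+1.-tuple R :=
  @cons_tuple R m \o
    (shear_fst (1 + c)^-1 b \o (shear_snd b \o shear_fst (1 + c)^-1 b)) \o
  @uncons_tuple m.

Lemma measure_preserving_rotation m (c : R) (b : m.-tuple R) :
  measure_preserving (lebesgue_tuple m.+1) (rotation c b).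
Proof.
apply: measure_preserving_cons.
apply: measure_preserving_comp; first exact: measure_preserving_shear_fst.
apply: measure_preserving_comp; last exact: measure_preserving_shear_fst.
exact: measure_preserving_shear_snd.
Qed.

Lemma dotD m (b x y : m.-tuple R) (s : R) :
  dot b [tuple tnth x i + s * tnth y i | i < m] = dot b x + s * dot b y.
Proof.
rewrite /dot mulr_sumr -big_split/=; apply: eq_bigr => i _.
by rewrite tnth_mktuple; ring.
Qed.

Lemma rotation0 m (c : R) (b : m.-tuple R) (x : m.+1.-tuple R) :
  c != -1 -> dot b b = 1 - c ^+ 2 ->
  tnth (rotation c b x) ord0 = c * tnth x ord0 - dot b (uncons_tuple x).2.
Proof.
move=> c1 bb; rewrite tnth_cons0/= dotD bb /thead; set D := dot b _; set t := tnth x _.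
by field; rewrite addrC -[1]opprK subr_eq0.
Qed.

Lemma rotationS m (c : R) (b : m.-tuple R) (x : m.+1.-tuple R) i :
  tnth (rotation c b x) (lift ord0 i) = tnth x (lift ord0 i) +
    (tnth x ord0 - (1 + c)^-1 * dot b (uncons_tuple x).2) * tnth b i.
Proof. by rewrite tnth_consS/= tnth_mktuple tnth_uncons. Qed.

End tuples.

(** * Rotations act transitively on the sphere *)

Section orthogonal.
Context {R : realType}.

(** What is used of a linear isometry: it preserves volume, distances and
    norms, and it commutes with the radial projection onto the sphere. *)
Record orthogonal_preserving m (f : m.-tuple R -> m.-tuple R) : Prop := {
  orthogonal_measure : measure_preserving (lebesgue_tuple m) f ;
  orthogonal_edist : forall x y, edist (f x) (f y) = edist x y ;
  orthogonal_enorm : forall x, enorm (f x) = enorm x ;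
  orthogonal_normalize : forall x, f (normalize x) = normalize (f x)
}.

Lemma orthogonal_preserving_comp m (f g : m.-tuple R -> m.-tuple R) :
  orthogonal_preserving f -> orthogonal_preserving g ->
  orthogonal_preserving (f \o g).
Proof.
move=> [mf df nf zf] [mg dg ng zg]; split=> [|x y|x|x] /=.
- exact: measure_preserving_comp.
- by rewrite df.
- by rewrite nf.
- by rewrite zg zf.
Qed.

(** [(s, d)] are the coordinates of a vector; with [b] normalized by
    [dot b b = 1 - c ^+ 2], expanding the squares leaves a rational identity in
    [c], [s], [dot b d] and the squared norm of [d]. *)
Lemma rotation_isometry m (c : R) (b d : m.-tuple R) (s : R) :
  c != -1 -> dot b b = 1 - c ^+ 2 ->
  (c * s - dot b d) ^+ 2 +
    \sum_(i < m) (tnth d i + (s - (1 + c)^-1 * dot b d) * tnth b i) ^+ 2 =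
  s ^+ 2 + \sum_(i < m) tnth d i ^+ 2.
Proof.
move=> c1 bb; set u := s - _.
have -> : \sum_(i < m) (tnth d i + u * tnth b i) ^+ 2 =
    \sum_(i < m) tnth d i ^+ 2 + 2 * u * dot b d + u ^+ 2 * dot b b.
  rewrite /dot !mulr_sumr -!big_split/=.
  by apply: eq_bigr => i _; ring.
rewrite bb /u; set D := dot b d; set N := \sum_(i < m) _.
by field; rewrite addrC -[1]opprK subr_eq0.
Qed.

Lemma orthogonal_preserving_rotation m (c : R) (b : m.-tuple R) :
  c != -1 -> dot b b = 1 - c ^+ 2 -> orthogonal_preserving (rotation c b).
Proof.
move=> c1 bb.
have nE x : enorm (rotation c b x) = enorm x.
  rewrite /enorm !big_ord_recl.
  have := rotation_isometry (uncons_tuple x).2 (tnth x ord0) c1 bb.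
  have -> : \sum_(i < m) tnth (uncons_tuple x).2 i ^+ 2 =
      \sum_(i < m) tnth x (lift ord0 i) ^+ 2.
    by apply: eq_bigr => i _; rewrite tnth_uncons.
  move=> <-; congr (Num.sqrt (_ + _)).
    by rewrite !rotation0.
  by apply: eq_bigr => i _; rewrite !rotationS tnth_uncons.
split=> [|x y|x|x].
- exact: measure_preserving_rotation.
- rewrite /edist !big_ord_recl.
  pose d := [tuple tnth x (lift ord0 i) - tnth y (lift ord0 i) | i < m].
  have dE : dot b d = dot b (uncons_tuple x).2 - dot b (uncons_tuple y).2.
    rewrite /dot -sumrB; apply: eq_bigr => i _.
    by rewrite tnth_mktuple !tnth_uncons mulrBr.
  have := rotation_isometry d (tnth x ord0 - tnth y ord0) c1 bb.
  have -> : \sum_(i < m) tnth d i ^+ 2 =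
      \sum_(i < m) (tnth x (lift ord0 i) - tnth y (lift ord0 i)) ^+ 2.
    by apply: eq_bigr => i _; rewrite tnth_mktuple.
  move=> <-; congr (Num.sqrt (_ + _)).
    by rewrite !rotation0// dE; ring.
  by apply: eq_bigr => i _; rewrite !rotationS tnth_mktuple dE; ring.
- exact: nE.
- have dE : dot b (uncons_tuple (normalize x)).2 = dot b (uncons_tuple x).2 / enorm x.
    rewrite /dot mulr_suml; apply: eq_bigr => i _.
    by rewrite !tnth_uncons tnth_mktuple mulrA.
  apply: eq_from_tnth => i; rewrite [RHS]tnth_mktuple nE.
  case: (unliftP ord0 i) => [j ->|->].
    by rewrite !rotationS dE !tnth_mktuple; ring.
  by rewrite !rotation0// dE tnth_mktuple; ring.
Qed.

Definition pole m : m.+1.-tuple R := cons_tuple (1, [tuple 0 | i < m]).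

Lemma rotation_pole m (c : R) (b : m.-tuple R) :
  c != -1 -> dot b b = 1 - c ^+ 2 -> rotation c b (pole m) = cons_tuple (c, b).
Proof.
move=> c1 bb.
have b0 : dot b (uncons_tuple (pole m)).2 = 0.
  rewrite /dot big1// => i _.
  by rewrite tnth_uncons tnth_consS tnth_mktuple mulr0.
apply: eq_from_tnth => i; case: (unliftP ord0 i) => [j ->|->].
  by rewrite rotationS b0 !tnth_consS/= tnth_mktuple !tnth_cons0/= mulr0 subr0 mul1r add0r.
by rewrite rotation0// b0 !tnth_cons0/= mulr1 subr0.
Qed.

(** The rotation with first column [x] works unless [x] is the antipode of the
    pole, where [1 + c] vanishes; the antipode is reached by two quarter turns
    in a coordinate plane, which exists because [0 < n]. *)
Lemma orthogonal_transitive n (x : n.+1.-tuple R) : (0 < n)%N -> unit_sphere n x ->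
  exists2 f, orthogonal_preserving f & f (pole n) = x.
Proof.
move=> n0; case: n n0 x => [//|n] _ x nx.
have x1 : tnth x ord0 ^+ 2 + dot (uncons_tuple x).2 (uncons_tuple x).2 = 1.
  rewrite -[RHS](expr1n _ 2) -[in RHS]nx /enorm sqr_sqrtr; last first.
    by apply: sumr_ge0 => i _; exact: sqr_ge0.
  rewrite big_ord_recl; congr (_ + _); apply: eq_bigr => i _.
  by rewrite tnth_uncons expr2.
have [xN1|xN1] := eqVneq (tnth x ord0) (-1); last first.
  have bb : dot (uncons_tuple x).2 (uncons_tuple x).2 = 1 - tnth x ord0 ^+ 2.
    by rewrite -x1; ring.
  exists (rotation (tnth x ord0) (uncons_tuple x).2).
    exact: orthogonal_preserving_rotation.
  by rewrite rotation_pole// -[RHS]uncons_tupleK.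
(* [c = 0] and a unit vector [b]: a quarter turn. *)
pose b := pole n.
have b1 : dot b b = 1 - 0 ^+ 2.
  rewrite /dot big_ord_recl !tnth_cons0 big1 => [|i _]; first by rewrite /=; ring.
  by rewrite !tnth_consS/= tnth_mktuple mulr0.
have c1 : 0 != -1 :> R by rewrite eq_sym oppr_eq0 oner_eq0.
exists (rotation 0 b \o rotation 0 b).
  by apply: orthogonal_preserving_comp; exact: orthogonal_preserving_rotation.
rewrite /= rotation_pole//.
have x0 i : tnth x (lift ord0 i) = 0.
  have /eqP : dot (uncons_tuple x).2 (uncons_tuple x).2 = 0.
    by move: x1; rewrite xN1 sqrrN expr1n; lra.
  rewrite psumr_eq0 => [/allP/(_ i)|j _]; last by rewrite -expr2 sqr_ge0.
  by rewrite mem_index_enum => /(_ isT)/=; rewrite -expr2 sqrf_eq0 tnth_uncons => /eqP.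
apply: eq_from_tnth => i; case: (unliftP ord0 i) => [j ->|->].
  by rewrite rotationS cons_tupleK/= b1 x0 tnth_consS tnth_cons0/=; field.
by rewrite rotation0// cons_tupleK/= b1 xN1 tnth_cons0/=; ring.
Qed.

End orthogonal.

(** * The surface measure: invariance, finiteness, distance to the pole *)

Section surface.
Context {R : realType}.

Lemma sqr_enorm m (x : m.-tuple R) : enorm x ^+ 2 = \sum_(i < m) tnth x i ^+ 2.
Proof. by rewrite /enorm sqr_sqrtr// sumr_ge0// => i _; exact: sqr_ge0. Qed.

Lemma enorm_ge0 m (x : m.-tuple R) : 0 <= enorm x.
Proof. exact: sqrtr_ge0. Qed.

Lemma sqr_enorm_cons m (p : measurableTypeR R * m.-tuple R) :
  enorm (cons_tuple p) ^+ 2 = p.1 ^+ 2 + enorm p.2 ^+ 2.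
Proof.
rewrite !sqr_enorm big_ord_recl tnth_cons0; congr (_ + _).
by apply: eq_bigr => i _; rewrite tnth_consS.
Qed.

Lemma enorm_normalize m (x : m.-tuple R) : 0 < enorm x -> enorm (normalize x) = 1.
Proof.
move=> x0; apply/eqP; rewrite -(@eqrXn2 _ 2) ?enorm_ge0// expr1n sqr_enorm.
under eq_bigr do rewrite tnth_mktuple expr_div_n.
by rewrite -mulr_suml -sqr_enorm divff// sqrf_eq0 gt_eqF.
Qed.

Lemma sqr_edist_pole m (x : m.+1.-tuple R) : enorm x = 1 ->
  edist (pole m) x ^+ 2 = 2 - 2 * tnth x ord0.
Proof.
move=> x1; rewrite /edist sqr_sqrtr; last first.
  by apply: sumr_ge0 => i _; exact: sqr_ge0.
have := sqr_enorm x; rewrite x1 expr1n !big_ord_recl tnth_cons0/= => e.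
under eq_bigr do rewrite tnth_consS tnth_mktuple sub0r sqrrN.
by rewrite [X in _ + X](_ : _ = 1 - tnth x ord0 ^+ 2); [ring|rewrite e; ring].
Qed.

Lemma measurable_edist m :
  measurable_fun setT (fun p : m.-tuple R * m.-tuple R => edist p.1 p.2).
Proof.
rewrite (_ : (fun _ => _) = (@powR R)^~ 2^-1 \o
    (fun p => \sum_(i < m) (tnth p.1 i - tnth p.2 i) ^+ 2)); last first.
  by apply/funext => x /=; rewrite powR12_sqrt// sumr_ge0// => i _; exact: sqr_ge0.
apply: measurableT_comp; first exact: measurable_powR.
apply: measurable_sum => i; apply: measurable_funX.
have mt := @measurable_tnth _ (R : measurableType _) m i.
by apply: measurable_funB; [exact: (measurableT_comp mt measurable_fst)|
  exact: (measurableT_comp mt measurable_snd)].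
Qed.

Lemma measurable_edist_preimage m (x : m.-tuple R) (E : set R) : measurable E ->
  measurable [set y | E (edist x y)].
Proof.
move=> mE; have := measurableT_comp (@measurable_edist m) (pair1_measurable x).
by move=> /(_ measurableT E mE); rewrite setTI.
Qed.

Lemma measurable_unit_sphere n : measurable (@unit_sphere R n).
Proof.
rewrite (_ : unit_sphere n = @enorm R n.+1 @^-1` [set 1])//.
by rewrite -[X in measurable X]setTI; apply: measurable_enorm.
Qed.

Lemma measurable_cone m (A : set (m.-tuple R)) : measurable A -> measurable (cone A).
Proof.
move=> mA; apply: measurableI; last exact: measurable_punctured_ball.
by rewrite -[X in measurable X]setTI; exact: measurable_normalize.
Qed.

Lemma surface_measure_orthogonal n (f : n.+1.-tuple R -> n.+1.-tuple R)
    (A : set (n.+1.-tuple R)) : orthogonal_preserving f -> measurable A ->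
  borel_surface_measure (f @^-1` A) = borel_surface_measure A.
Proof.
move=> [mf df nf zf] mA; rewrite /borel_surface_measure.
rewrite (_ : cone (f @^-1` A) = f @^-1` (cone A)).
  by rewrite mf.2//; exact: measurable_cone.
by apply/seteqP; split => x; rewrite /cone /punctured_ball /preimage/= zf nf.
Qed.

Lemma surface_measure_setC_sphere n :
  borel_surface_measure (~` @unit_sphere R n) = 0%E.
Proof.
rewrite /borel_surface_measure (_ : cone _ = set0) ?measure0 ?mule0//.
apply/seteqP; split=> // x [/= + /andP[x0 _]].
by apply; exact: enorm_normalize.
Qed.

(** Gives finiteness of the surface measure, the unit ball being contained in
    the unit cube. *)
Lemma cube_sub_finite_measure m : exists2 B : set (m.-tuple R),
  measurable B /\ (lebesgue_tuple m B < +oo)%E &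
  [set x : m.-tuple R | forall i, `|tnth x i| <= 1] `<=` B.
Proof.
elim: m => [|m [B [mB Boo] sB]].
  exists setT => //; split => //=.
  by rewrite diracT ltry.
exists (@uncons_tuple R m @^-1` (`[-1, 1] `*` B)).
  have mP : measurable (`[-1, 1]%classic `*` B : set (measurableTypeR R * m.-tuple R)).
    by apply: measurableX => //; exact: measurable_itv.
  split; first by rewrite -[X in measurable X]setTI; exact: measurable_uncons_tuple.
  rewrite /= /lebesgue_tuple_succ /pushforward -comp_preimage.
  rewrite (_ : _ \o _ = id); last by apply/funext => p /=; rewrite cons_tupleK.
  rewrite preimage_id product_measure1E//.
  have l2 : (@lebesgue_measure R `[(-1)%R, 1%R]%classic < +oo)%E.
    by rewrite lebesgue_measure_itv/= lte_fin; case: ifPn => // _; rewrite -EFinD ltry.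
  by rewrite lte_mul_pinfty// ge0_fin_numE.
move=> x /= x1; split => /=.
  by rewrite in_itv/= -ler_norml; exact: x1.
by apply: sB => i /=; rewrite -[X in tnth X i]/((uncons_tuple x).2) tnth_uncons.
Qed.

Lemma surface_measure_finite n : (@borel_surface_measure R n setT < +oo)%E.
Proof.
have [B [mB Boo] sB] := cube_sub_finite_measure n.+1.
rewrite /borel_surface_measure lte_mul_pinfty// (le_lt_trans _ Boo)//.
apply: le_measure; rewrite ?inE//.
  by apply: measurable_cone; exact: measurableT.
move=> x [_ /andP[_ x1]]; apply: sB => i /=.
rewrite (le_trans _ x1)// -[leLHS]sqrtr_sqr.
rewrite ler_wsqrtr// (bigD1 i)//= lerDl sumr_ge0// => j _.
exact: sqr_ge0.
Qed.

Lemma norm_le_sqr (u v : R) : 0 <= v -> u ^+ 2 <= v ^+ 2 -> `|u| <= v.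
Proof.
by move=> v0 uv; rewrite -(@ler_pXn2r _ 2)// ?nnegrE// real_normK ?num_real.
Qed.

(** [t / p] is the first coordinate of the direction of a vector with first
    coordinate [t] and norm [p], whose other coordinates have norm [r]. On the
    unit ball the derivative of [t |-> t / p], which is [r ^+ 2 / p ^+ 3], is
    bounded below; the inequality is obtained here by algebra from
    [t * q - s * p = (t - s) * (r ^+ 2 + p * q - t * s) / (p + q)]. *)
Lemma direction_expanding (r s t p q : R) : 0 < p <= 1 -> 0 < q <= 1 ->
  p ^+ 2 = t ^+ 2 + r ^+ 2 -> q ^+ 2 = s ^+ 2 + r ^+ 2 ->
  `|s - t| * r ^+ 2 <= 2 * `|t / p - s / q|.
Proof.
move=> /andP[p0 p1] /andP[q0 q1] pE qE.
have pq0 : 0 < p * q * (p + q) by rewrite !mulr_gt0// addr_gt0.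
have tsE : t / p - s / q = (t - s) * (r ^+ 2 + p * q - t * s) / (p * q * (p + q)).
  apply/eqP; rewrite -subr_eq0; apply/eqP.
  transitivity (((p ^+ 2 - t ^+ 2 - r ^+ 2) * s - (q ^+ 2 - s ^+ 2 - r ^+ 2) * t) *
      - (p * q * (p + q))^-1).
    by field; rewrite !gt_eqF// addr_gt0.
  by rewrite pE qE; ring.
have tp : `|t| <= p by apply: norm_le_sqr; rewrite ?(ltW p0)// pE lerDl sqr_ge0.
have sq : `|s| <= q by apply: norm_le_sqr; rewrite ?(ltW q0)// qE lerDl sqr_ge0.
have ts : t * s <= p * q.
  by rewrite (le_trans (ler_norm _))// normrM ler_pM.
have pq2 : p * q * (p + q) <= 2.
  have : p * q <= 1 by apply: mulr_ile1 => //; exact: ltW.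
  move=> pq1; rewrite (@le_trans _ _ (1 * (p + q)))//; last by lra.
  by rewrite ler_wpM2r// addr_ge0// ltW.
have r0 := sqr_ge0 r.
have ge : r ^+ 2 / 2 <= (r ^+ 2 + p * q - t * s) / (p * q * (p + q)).
  rewrite ler_pdivlMr// mulrAC ler_pdivrMr// ler_pM//; [exact: ltW|by lra].
rewrite tsE -[_ / _]mulrA normrM (distrC t) [leRHS]mulrCA ler_wpM2l//.
rewrite ger0_norm; first by lra.
by apply: le_trans ge; rewrite divr_ge0.
Qed.

(** Along a line parallel to the first axis, the distance from the pole to the
    radial projection separates points: its square is [2 - 2 * c] with [c] the
    first coordinate of the direction, and distances are at most [2], so
    that [c] is a [2]-Lipschitz function of the distance. *)
Lemma edist_pole_expanding m (y : m.-tuple R) (s t : R) :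
  let g t := edist (pole m) (normalize (cons_tuple (t : measurableTypeR R, y))) in
  0 < enorm y -> t ^+ 2 + enorm y ^+ 2 <= 1 -> s ^+ 2 + enorm y ^+ 2 <= 1 ->
  `|s - t| <= 4 / enorm y ^+ 2 * `|g s - g t|.
Proof.
move=> g y0.
have key u : u ^+ 2 + enorm y ^+ 2 <= 1 ->
    let p := enorm (cons_tuple (u : measurableTypeR R, y)) in
    [/\ 0 < p <= 1, p ^+ 2 = u ^+ 2 + enorm y ^+ 2, 0 <= g u <= 2 &
        g u ^+ 2 = 2 - 2 * (u / p)].
  move=> u1 p; have pE : p ^+ 2 = u ^+ 2 + enorm y ^+ 2 by rewrite sqr_enorm_cons.
  have p0 : 0 < p.
    rewrite lt_def enorm_ge0 andbT -sqrf_eq0 pE gt_eqF//.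
    by rewrite ltr_wpDl ?sqr_ge0// exprn_gt0.
  have p1 : p <= 1 by rewrite -(@ler_pXn2r _ 2) ?nnegrE ?enorm_ge0// pE expr1n.
  have gE : g u ^+ 2 = 2 - 2 * (u / p).
    rewrite sqr_edist_pole; last exact: enorm_normalize.
    by rewrite tnth_mktuple tnth_cons0.
  split => //; first by rewrite p0.
  rewrite sqrtr_ge0/= -(@ler_pXn2r _ 2) ?nnegrE ?sqrtr_ge0// gE.
  suff : - 1 <= u / p by lra.
  rewrite ler_pdivlMr// mulN1r lerNl.
  rewrite (le_trans (ler_norm _))// normrN.
  by apply: norm_le_sqr; rewrite ?(ltW p0)// pE lerDl sqr_ge0.
move=> /key[p01 pE g2 gE] /key[q01 qE g2' gE'].
have := direction_expanding p01 q01 pE qE.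
set c := t / _; set c' := s / _ => le1.
rewrite mulrAC ler_pdivlMr ?exprn_gt0//; apply: (le_trans le1).
have -> : c - c' = (g s - g t) * ((g s + g t) / 2).
  transitivity ((g s ^+ 2 - g t ^+ 2) / 2); last by field.
  by rewrite gE gE' -/c -/c'; field.
rewrite normrM mulrCA mulrC ler_wpM2r// ger0_norm; last by lra.
by lra.
Qed.

End surface.

(** * The law of the distance to a point of the sphere *)

Section distance_to_a_point.
Context {R : realType}.

Lemma measurable_enorm_eq0 m : measurable [set y : m.-tuple R | enorm y = 0].
Proof.
rewrite (_ : [set y | _] = @enorm R m @^-1` [set 0])//.
by rewrite -[X in measurable X]setTI; apply: measurable_enorm.
Qed.

Lemma lebesgue_tuple_enorm_eq0 m :
  lebesgue_tuple m.+1 [set y : m.+1.-tuple R | enorm y = 0] = 0%E.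
Proof.
rewrite /= /lebesgue_tuple_succ /pushforward; apply/eqP.
rewrite eq_le measure_ge0 andbT.
have mX : measurable ([set 0] `*` setT : set (measurableTypeR R * m.-tuple R)).
  by apply: measurableX.
apply: (@le_trans _ _ ((lebesgue_measure \x lebesgue_tuple m)%E ([set 0] `*` setT))).
  apply: le_measure; rewrite ?inE//.
    rewrite -[X in measurable X]setTI; apply: measurable_cons_tuple => //.
    exact: measurable_enorm_eq0.
  move=> p /= p0; split => //=.
  have := sqr_enorm_cons p; rewrite p0 expr0n/= => /esym/eqP.
  by rewrite paddr_eq0 ?sqr_ge0// sqrf_eq0 => /andP[/eqP].
rewrite product_measure1E//.
rewrite (_ : _ [set 0] = 0%E) ?mul0e//.
exact: lebesgue_measure_set1.
Qed.

(** The distance to the pole has an absolutely continuous law under the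
    surface measure: on the cone over the exceptional set, Fubini reduces to
    lines parallel to the first axis, on which the distance to the pole of the
    radial projection is expanding, except for the axis itself. *)
Lemma surface_edist_pole_null n (E : set R) : (0 < n)%N ->
  measurable E -> lebesgue_measure E = 0%E ->
  borel_surface_measure [set y | E (edist (pole n) y)] = 0%E.
Proof.
case: n => // m _ mE E0; rewrite /borel_surface_measure.
rewrite [X in (_ * X)%E](_ : _ = 0%E) ?mule0//.
set A := cone _.
have mA : measurable A by apply: measurable_cone; exact: measurable_edist_preimage.
have mcA : measurable (@cons_tuple R m.+1 @^-1` A).
  by have := @measurable_cons_tuple R m.+1 measurableT _ mA; rewrite setTI.
rewrite -[LHS]/((lebesgue_measure \x lebesgue_tuple m.+1)%E (@cons_tuple R m.+1 @^-1` A)).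
rewrite product_measure_ysection//.
(* The first axis projects to the origin of R^(m+1), a null set. *)
rewrite (ge0_negligible_integral (@measurable_enorm_eq0 m.+1))//; last 2 first.
- exact: measurable_fun_ysection.
- exact: lebesgue_tuple_enorm_eq0.
apply: integral0_eq => y [_ /= /eqP y0].
have {}y0 : 0 < enorm y by rewrite lt_def y0 enorm_ge0.
pose g (t : R) := edist (pole m.+1) (normalize (cons_tuple (t : measurableTypeR R, y))).
have mg : measurable_fun [set: R] g.
  exact: (measurableT_comp (measurableT_comp (@measurable_edist R _)
    (pair1_measurable (pole m.+1))) (measurableT_comp (@measurable_normalize R _)
    (measurableT_comp (@measurable_cons_tuple R m.+1) (pair2_measurable y)))).
pose D := [set t : R | t ^+ 2 + enorm y ^+ 2 <= 1].
have mD : measurable D.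
  rewrite (_ : D = (fun t => t ^+ 2 + enorm y ^+ 2) @^-1` `]-oo, 1]); last first.
    by apply/seteqP; split => t; rewrite /D /= in_itv.
  rewrite -[X in measurable X]setTI.
  have : measurable_fun setT (fun t : R => t ^+ 2 + enorm y ^+ 2).
    by apply: measurable_funD => //; exact: measurable_funX.
  by apply => //; exact: measurable_itv.
apply/eqP; rewrite eq_le measure_ge0 andbT.
rewrite -(@expanding_preimage_null R D E g (4 / enorm y ^+ 2) mD mg _ mE E0); last first.
  by move=> s t Ds Dt; exact: edist_pole_expanding.
apply: le_measure; rewrite ?inE.
- exact: measurable_ysection.
- by apply: measurableI => //; rewrite -[X in measurable X]setTI; exact: mg.
move=> t /ysectionP[/= Et /andP[_ t1]]; split=> //; rewrite /D/=.
by rewrite -[_ + _](sqr_enorm_cons (t : measurableTypeR R, y)) -[leRHS](expr1n _ 2)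
  ler_pXn2r ?nnegrE ?enorm_ge0.
Qed.

Lemma surface_edist_invariant n (x : n.+1.-tuple R) (E : set R) : (0 < n)%N ->
  unit_sphere n x -> measurable E ->
  borel_surface_measure [set y | E (edist x y)] =
  borel_surface_measure [set y | E (edist (pole n) y)].
Proof.
move=> n0 nx mE; have [f fo <-] := orthogonal_transitive n0 nx.
have mA := measurable_edist_preimage (f (pole n)) mE.
rewrite -[LHS](surface_measure_orthogonal fo mA); congr borel_surface_measure.
by apply/seteqP; split=> y; rewrite /preimage/= (orthogonal_edist fo).
Qed.

End distance_to_a_point.

(** * Borel representatives and the completed measure *)

Section completion.
Context {R : realType} d (T : measurableType d) (mu : {measure set T -> \bar R}).
Hypothesis mu_fin : (mu setT < +oo)%E.
Notation outer := (mu^*)%mu.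
Notation completion := (@completed_measure_extension _ T R mu).

(** The intersection of a sequence of covers whose measures approach the
    infimum defining [outer A]. *)
Lemma measurable_outer_hull (A : set T) :
  exists B, [/\ measurable B, A `<=` B & (mu B <= outer A)%E].
Proof.
have outer_fin : outer A \is a fin_num.
  rewrite ge0_fin_numE ?outer_measure_ge0//.
  rewrite (le_lt_trans _ mu_fin)//.
  by rewrite -measurable_mu_extE//; apply: le_outer_measure.
have cover k : exists U, [/\ measurable U, A `<=` U &
    (mu U <= outer A + (k.+1%:R^-1)%:E)%E].
  have k0 : 0 < k.+1%:R^-1 :> R by rewrite invr_gt0.
  have [_ [F [mF AF] <-] FA] := lb_ereal_inf_adherent k0 outer_fin.
  exists (\bigcup_i F i); split => //; first exact: bigcupT_measurable.
  rewrite (le_trans _ (ltW FA))//.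
  by apply: measure_sigma_subadditive => //; exact: bigcupT_measurable.
pose U k := projT1 (cid (cover k)).
have UP k : [/\ measurable (U k), A `<=` U k &
    (mu (U k) <= outer A + (k.+1%:R^-1)%:E)%E] by rewrite /U; case: cid.
have mU : measurable (\bigcap_k U k).
  by apply: bigcapT_measurable => k; have [] := UP k.
exists (\bigcap_k U k); split => //.
  by move=> x Ax k _; have [_ + _] := UP k; exact.
apply/lee_addgt0Pr => _/posnumP[e]; near \oo => k.
have [mUk _ Uk] := UP k.
apply: (@le_trans _ _ (mu (U k))).
  by apply: le_measure; rewrite ?inE//; exact: bigcap_inf.
rewrite (le_trans Uk)// leeD2l// lee_fin ltW//.
by near: k; exact: near_infty_natSinv_lt.
Unshelve. all: by end_near. Qed.

Definition almost_eq (A B : set T) := outer (A `\` B) = 0%E /\ outer (B `\` A) = 0%E.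

(** A Caratheodory measurable set differs from a hull [B] of the same outer
    measure by a null set, as its cut of [B] is additive. *)
Lemma caratheodory_almost_eq (A : set T) : outer.-cara.-measurable A ->
  exists2 B, measurable B & almost_eq A B.
Proof.
move=> mA; have [B [mB AB BA]] := measurable_outer_hull A.
exists B => //; split.
  by rewrite (_ : A `\` B = set0) ?outer_measure0// setD_eq0.
have Bfin : outer B \is a fin_num.
  rewrite measurable_mu_extE// ge0_fin_numE// (le_lt_trans _ mu_fin)//.
  by rewrite le_measure// inE.
have /esym := mA B; rewrite (setIidr AB) -setDE => BE.
have Afin : outer A \is a fin_num.
  rewrite ge0_fin_numE ?outer_measure_ge0//.
  by rewrite (le_lt_trans (le_outer_measure outer _ _ AB))// ltey_eq Bfin.
apply/eqP; rewrite eq_le outer_measure_ge0 andbT.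
rewrite -(leeD2lE _ _ Afin) adde0 BE.
by move: BA; rewrite -(measurable_mu_extE mu mB).
Qed.

(** Integrals for the completed measure reduce to integrals for [mu] itself,
    for which Fubini's theorem is available. *)
Lemma integral_almost_eq (A B : set T) (f : T -> \bar R) :
  outer.-cara.-measurable A -> measurable B -> almost_eq A B ->
  measurable_fun setT f -> (forall x, (0 <= f x)%E) ->
  (\int[completion]_(x in A) f x = \int[mu]_(x in B) f x)%E.
Proof.
move=> mA mB [AB BA] mf f0.
pose C := caratheodory_type outer.
have borel_cara (X : set T) : measurable X -> outer.-cara.-measurable X.
  exact: caratheodory_measurable_mu_ext.
have mid : measurable_fun [set: C] (id : C -> T).
  by move=> _ X mX; rewrite setTI; exact: borel_cara.
have mfC : measurable_fun [set: C] (f : C -> \bar R) by exact: (measurableT_comp mf mid).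
have mBC := borel_cara _ mB.
have null (X Y : set T) : outer.-cara.-measurable X -> outer.-cara.-measurable Y ->
    outer (X `\` Y) = 0%E ->
    (\int[completion]_(x in X) f x =
     \int[completion]_(x in X `&` Y) f x)%E.
  move=> mX mY XY.
  rewrite (@ge0_negligible_integral _ C R _ X (X `\` Y))//.
  - by rewrite setDD.
  - exact: measurableD.
  - exact: measurable_funS mfC.
rewrite (null A B)// setIC -(null B A)//.
(* The completion restricts to [mu] on [d.-measurable], that is, its image under
   the identity is [mu]. *)
transitivity (\int[pushforward (completion) (id : C -> T)]_(x in B) f x)%E.
  by rewrite ge0_integral_pushforward//; exact: measurable_funS mf.
by apply: eq_measure_integral => X mX _; exact: (measurable_mu_extE mu mX).
Qed.

End completion.

(** * The law of the distance between two sets *)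

Section distance_mass.
Context {R : realType} (n : nat).
Notation T := (n.+1.-tuple R).
Notation mu := (@borel_surface_measure R n).

Lemma fin_num_fun_surface_measure : fin_num_fun mu.
Proof.
move=> A mA; rewrite ge0_fin_numE//; apply: le_lt_trans (surface_measure_finite n).
by apply: le_measure; rewrite ?inE//; exact: measurableT.
Qed.

HB.instance Definition _ := Measure_isFinite.Build _ _ _ mu fin_num_fun_surface_measure.

Lemma surface_measure_setC (A : set T) : measurable A ->
  mu (~` A) = (mu setT - mu A)%E.
Proof.
by move=> mA; rewrite -setTD measureD// ?setTI// -ge0_fin_numE// fin_num_measure.
Qed.

(** As a function of [E], the law of the distance on [A `*` B]; it is a function
    of sets of distances, rather than of [l], because the complement identities
    and absolute continuity are identities between measures. *)
Definition distance_mass (A B : set T) (E : set R) : \bar R :=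
  (mu \x mu)%E ((A `*` B) `&` [set p | E (edist p.1 p.2)]).

Lemma measurable_distance_mass (A B : set T) (E : set R) :
  measurable A -> measurable B -> measurable E ->
  measurable ((A `*` B) `&` [set p | E (edist p.1 p.2)]).
Proof.
move=> mA mB mE; apply: measurableI; first exact: measurableX.
by have := @measurable_edist R n.+1 measurableT _ mE; rewrite setTI.
Qed.

Lemma distance_mass_fin_num (A B : set T) (E : set R) :
  measurable A -> measurable B -> measurable E -> distance_mass A B E \is a fin_num.
Proof.
move=> mA mB mE; rewrite ge0_fin_numE//.
apply: (@le_lt_trans _ _ ((mu \x mu)%E (setT `*` setT))).
  by apply: le_measure; rewrite ?inE//; [exact: measurable_distance_mass|exact: measurableX].
by rewrite product_measure1E// ltey_eq fin_numM// fin_num_measure.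
Qed.

Lemma distance_mass_integral (A B : set T) (E : set R) :
  distance_mass A B E = (\int[mu]_(x in A) mu (B `&` [set y | E (edist x y)]))%E.
Proof.
rewrite [RHS]integral_mkcond; apply: eq_integral => x _ /=.
rewrite patchE; case: ifPn => xA.
  congr (mu _); apply/seteqP; split => y.
    by move=> /xsectionP[[_ By] Ey].
  by move=> [By Ey]; apply/xsectionP; split => //; split => //; move: xA; rewrite inE.
rewrite (_ : xsection _ _ = set0) ?measure0//.
apply/seteqP; split => // y /xsectionP[[/= Ax _] _].
by move: xA; rewrite notin_setE.
Qed.

Lemma distance_mass_sym (A B : set T) (E : set R) :
  measurable A -> measurable B -> measurable E -> distance_mass A B E = distance_mass B A E.
Proof.
move=> mA mB mE; rewrite /distance_mass product_measure_ysection; last first.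
  exact: measurable_distance_mass.
apply: eq_integral => y _ /=; congr (mu _).
have edistC (u v : T) : edist u v = edist v u.
  by rewrite /edist; under eq_bigr do rewrite -sqrrN opprB.
by apply/seteqP; split => x => [/ysectionP|/xsectionP] [[/= ? ?] ?];
  [apply/xsectionP|apply/ysectionP]; split => //=; rewrite edistC.
Qed.

Lemma distance_mass_setC (A B : set T) (E : set R) :
  measurable A -> measurable B -> measurable E ->
  distance_mass A (~` B) E = (distance_mass A setT E - distance_mass A B E)%E.
Proof.
move=> mA mB mE.
have -> : distance_mass A setT E = (distance_mass A (~` B) E + distance_mass A B E)%E.
  rewrite /distance_mass -measureU.
  - congr ((mu \x mu)%E _); rewrite -setIUl; congr (_ `&` _).
    apply/seteqP; split=> -[x y] /=; last by case=> -[].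
    by case: (pselect (B y)) => ? []; [right|left].
  - by apply: measurable_distance_mass => //; exact: measurableC.
  - exact: measurable_distance_mass.
  - by apply/seteqP; split => // -[x y] /= [[[_ +] _] [[_ +] _]].
by rewrite addeK// distance_mass_fin_num.
Qed.

(** For almost every [x] (those on the sphere) the inner integral does not
    depend on [x], by rotation invariance. This is where the geometry of the
    sphere enters the complement identities. *)
Lemma distance_mass_setT (A : set T) (E : set R) : (0 < n)%N ->
  measurable A -> measurable E ->
  distance_mass A setT E = (mu A * mu [set y | E (edist (pole n) y)])%E.
Proof.
move=> n0 mA mE; rewrite distance_mass_integral.
have mS : measurable (~` @unit_sphere R n).
  by apply: measurableC; exact: measurable_unit_sphere.
have S0 := surface_measure_setC_sphere (R := R) n.
have mf : measurable_fun setT (fun x : T => mu (setT `&` [set y | E (edist x y)])).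
  rewrite (_ : (fun _ => _) = mu \o xsection [set p : T * T | E (edist p.1 p.2)]).
    apply: measurable_fun_xsection.
    by have := @measurable_edist R n.+1 measurableT _ mE; rewrite setTI.
  by apply/funext => x /=; rewrite setTI xsectionE.
rewrite (ge0_negligible_integral mS)//; last exact: measurable_funS mf.
rewrite (eq_integral (cst (mu [set y | E (edist (pole n) y)]))); last first.
  move=> x; rewrite inE => -[Ax /contrapT Sx].
  by rewrite setTI; exact: surface_edist_invariant.
rewrite integral_cst//; last exact: measurableD.
rewrite muleC; congr (_ * _)%E.
have AS0 : mu (A `&` ~` unit_sphere n) = 0%E.
  apply/eqP; rewrite eq_le measure_ge0 andbT -S0.
  by apply: le_measure; rewrite ?inE//; exact: measurableI.
by rewrite -[LHS]adde0 -[X in (_ + X)%E]AS0 -measureDI.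
Qed.

End distance_mass.

(** * Cumulative functions of the distance *)

Section distance_law.
Context {R : realType} (n : nat).
Notation T := (n.+1.-tuple R).
Notation mu := (@borel_surface_measure R n).
Variables (A : set T) (mA : measurable A).

Let mAA : measurable (A `*` A). Proof. exact: measurableX. Qed.

(** [distance_mass A A], in a form that carries the proof of measurability of [A], from
    which the measure structure is inferred. *)
Definition distance_law : set (measurableTypeR R) -> \bar R :=
  pushforward (mrestr (mu \x mu)%E mAA) (fun p => edist p.1 p.2 : measurableTypeR R).

Lemma distance_lawE E : distance_law E = distance_mass A A E.
Proof. by rewrite /distance_law /distance_mass /pushforward /mrestr setIC. Qed.

Let mdist : measurable_fun setT (fun p : T * T => edist p.1 p.2 : measurableTypeR R).
Proof. exact: measurable_edist. Qed.

Let law0 : distance_law set0 = 0%E.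
Proof. by rewrite /distance_law /pushforward preimage_set0 measure0. Qed.

Let law_ge0 E : (0 <= distance_law E)%E.
Proof. exact: measure_ge0. Qed.

Let law_sigma_additive : semi_sigma_additive distance_law.
Proof.
by apply: measure_semi_sigma_additive; exact: mdist.
Qed.

HB.instance Definition _ := isMeasure.Build _ _ _ distance_law
  law0 law_ge0 law_sigma_additive.

Let law_fin : fin_num_fun distance_law.
Proof. by move=> E mE; rewrite distance_lawE distance_mass_fin_num. Qed.

HB.instance Definition _ := Measure_isFinite.Build _ _ _ distance_law law_fin.

Lemma distance_law_dominated : (0 < n)%N -> distance_law `<< @lebesgue_measure R.
Proof.
move=> n0; apply/null_content_dominatesP => E mE E0.
apply/eqP; rewrite eq_le measure_ge0 andbT.
apply: (@le_trans _ _ (distance_mass A setT E)).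
  rewrite distance_lawE /distance_mass.
  apply: le_measure; rewrite ?inE; [exact: measurable_distance_mass..|].
  by move=> p [[]].
by rewrite distance_mass_setT// surface_edist_pole_null// mule0.
Qed.

End distance_law.

Section cumulative.
Context {R : realType} (n : nat).
Notation T := (n.+1.-tuple R).
Notation mu := (@borel_surface_measure R n).

(** The cumulative functions of the statement, written with the completed
    surface measure, computed on Borel representatives of the two sets. *)
Lemma St2_distance_mass (A A' B B' : set T) (l : R) :
  (mu^*)%mu.-cara.-measurable A -> (mu^*)%mu.-cara.-measurable A' ->
  measurable B -> measurable B' -> almost_eq mu A B -> almost_eq mu A' B' ->
  St2 A A' l = fine (distance_mass B B' `]-oo, l[%classic).
Proof.
move=> mA mA' mB mB' AB AB'; rewrite distance_mass_integral /St2 {1}/Rintegral.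
congr fine.
have mE (x : T) : measurable [set y | (`]-oo, l[%classic : set R) (edist x y)].
  by apply: measurable_edist_preimage; exact: measurable_itv.
transitivity (\int[surface_measure n]_(x in A)
    mu (B' `&` [set y | (`]-oo, l[%classic : set R) (edist x y)]))%E.
  apply: eq_integral => x _; rewrite /Rintegral.
  have hE : (fun y : T => (heaviside (l - edist x y))%:E) =
      (fun y => (\1_[set y | (`]-oo, l[%classic : set R) (edist x y)] y)%:E).
    apply/funext => y; rewrite /heaviside indicE subr_gt0.
    case: ifPn => yl; [rewrite mem_set//=|rewrite memNset//=]; rewrite in_itv//=.
    exact/negP.
  have mh : measurable_fun setT (fun y : T => (heaviside (l - edist x y))%:E).
    by rewrite hE; exact/measurable_EFinP.
  have h0 (y : T) : (0 <= (heaviside (l - edist x y))%:E)%E.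
    by rewrite lee_fin /heaviside; case: ifP.
  rewrite [X in (fine X)%:E](integral_almost_eq mA' mB' AB' mh h0).
  rewrite hE integral_indic// setIC fineK//.
  by apply: fin_num_measure; exact: measurableI.
apply: (integral_almost_eq mA mB AB) => [|x]; last exact: measure_ge0.
have mX := @measurable_distance_mass R n setT B' `]-oo, l[%classic
  measurableT mB' (measurable_itv _).
rewrite (_ : (fun _ => _) = mu \o xsection
    ((setT `*` B') `&` [set p : T * T | (`]-oo, l[%classic : set R) (edist p.1 p.2)])).
  exact: measurable_fun_xsection.
apply/funext => x /=; congr (mu _); apply/seteqP; split => y.
  by move=> [B'y xy]; apply/xsectionP.
by move=> /xsectionP[[]].
Qed.

(** The surface measure does not charge the complement of the sphere, so the
    complement of a Borel representative may be taken in the whole space. *)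
Lemma almost_eq_setC (A B : set T) :
  sphere_measurable A -> measurable B -> almost_eq mu A B ->
  almost_eq mu (unit_sphere n `\` A) (~` B).
Proof.
move=> [AS mA] mB [AB BA]; split; apply/eqP; rewrite eq_le outer_measure_ge0 andbT.
  rewrite -BA; apply: le_outer_measure => x [[Sx nAx] /contrapT Bx].
  by split.
apply: (@le_trans _ _ ((mu^*)%mu (~` unit_sphere n) + (mu^*)%mu (A `\` B))%E).
  apply: le_trans (outer_measureU2 _ _ _).
  apply: le_outer_measure => x [nBx SAx].
  have [Sx|nSx] := pselect (unit_sphere n x); last by left.
  by right; split => //; apply: contrapT => nAx; apply: SAx.
have mS : measurable (~` @unit_sphere R n).
  by apply: measurableC; exact: measurable_unit_sphere.
have S0 : (mu^*)%mu (~` unit_sphere n) = 0%E.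
  exact: etrans (measurable_mu_extE mu mS) (surface_measure_setC_sphere n).
by rewrite AB adde0 S0.
Qed.

Lemma sphere_measurable_setC (A : set T) : sphere_measurable A ->
  (mu^*)%mu.-cara.-measurable (unit_sphere n `\` A).
Proof.
move=> [_ mA]; apply: measurableD => //.
by apply: caratheodory_measurable_mu_ext; exact: measurable_unit_sphere.
Qed.

End cumulative.

Theorem theorem2 (R : realType) (n : nat) (hn : (1 <= n)%N)
  (S S' : set (n.+1.-tuple R))
  (mS : sphere_measurable S) (mS' : sphere_measurable S')
  (hst : density_eq (st S) (st S')) :
  density_eq (st (unit_sphere n `\` S)) (st (unit_sphere n `\` S')) /\
  density_eq (st2 S (unit_sphere n `\` S)) (st2 S' (unit_sphere n `\` S')).
Proof.
set mu := @borel_surface_measure R n.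
have [B mB SB] := caratheodory_almost_eq (surface_measure_finite n) mS.2.
have [B' mB' SB'] := caratheodory_almost_eq (surface_measure_finite n) mS'.2.
have StE (X Y : set (n.+1.-tuple R)) : sphere_measurable X -> measurable Y ->
    almost_eq mu X Y -> [/\ St X = (fun l => fine (distance_mass Y Y `]-oo, l[%classic)),
      St (unit_sphere n `\` X) =
        (fun l => fine (distance_mass (~` Y) (~` Y) `]-oo, l[%classic)) &
      St2 X (unit_sphere n `\` X) =
        (fun l => fine (distance_mass Y (~` Y) `]-oo, l[%classic))].
  move=> mX mY XY; have mXC := sphere_measurable_setC mX.
  have XYC := almost_eq_setC mX mY XY.
  have mYC := measurableC mY.
  by case: mX => _ mX; split; apply/funext => l; exact: St2_distance_mass.
have [StS StC StSC] := StE _ _ mS mB SB.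
have [StS' StC' StSC'] := StE _ _ mS' mB' SB'.
have lawE E : measurable E -> distance_mass B B E = distance_mass B' B' E.
  rewrite -(distance_lawE mB) -(distance_lawE mB').
  apply: (@eq_dominated_measure R (distance_law mB) (distance_law mB')).
  - exact: distance_law_dominated.
  - exact: distance_law_dominated.
  - move: hst; rewrite /density_eq /st.
    have -> : St S = (fun l => fine (distance_law mB `]-oo, l[%classic)).
      by rewrite StS; apply/funext => l; rewrite distance_lawE.
    have -> // : St S' = (fun l => fine (distance_law mB' `]-oo, l[%classic)).
    by rewrite StS'; apply/funext => l; rewrite distance_lawE.
(* The total mass of the law of the distance is the square of the surface. *)
have muE : mu B = mu B'.
  have muK X : measurable X -> mu X = (fine (mu X))%:E.
    by move=> mX; rewrite fineK// fin_num_measure.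
  have sq X : measurable X -> distance_mass X X setT = (fine (mu X) ^+ 2)%:E.
    move=> mX; rewrite /distance_mass [X in _ `&` X](_ : _ = setT)// setIT product_measure1E//.
    by rewrite expr2 EFinM -muK.
  have := lawE _ measurableT; rewrite (sq _ mB) (sq _ mB') => -[/eqP].
  rewrite eqrXn2 ?fine_ge0// => /eqP mue.
  by rewrite (muK B)// mue -muK.
(* [distance_mass B setT] depends on [B] through its measure only. *)
have mixedE E : measurable E -> distance_mass B (~` B) E = distance_mass B' (~` B') E.
  move=> mE; rewrite (distance_mass_setC mB mB mE) (distance_mass_setC mB' mB' mE) (lawE _ mE).
  rewrite (distance_mass_setT hn mB mE) (distance_mass_setT hn mB' mE).
  congr (_ * _ - _)%E; exact: muE.
have compE E : measurable E -> distance_mass (~` B) (~` B) E = distance_mass (~` B') (~` B') E.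
  move=> mE; have mBC := measurableC mB; have mBC' := measurableC mB'.
  rewrite (distance_mass_setC mBC mB mE) (distance_mass_setC mBC' mB' mE).
  rewrite (distance_mass_sym mBC mB mE) (distance_mass_sym mBC' mB' mE) (mixedE _ mE).
  rewrite (distance_mass_setT hn mBC mE) (distance_mass_setT hn mBC' mE).
  congr (_ * _ - _)%E; apply: etrans (surface_measure_setC mB) _.
  by rewrite -/mu muE -(surface_measure_setC mB').
have StCE : St (unit_sphere n `\` S) = St (unit_sphere n `\` S').
  apply: etrans StC _; apply: etrans _ (esym StC'); apply/funext => l.
  apply: (congr1 fine).
  exact: (compE _ (measurable_itv `]-oo, l[)).
have StSCE : St2 S (unit_sphere n `\` S) = St2 S' (unit_sphere n `\` S').
  apply: etrans StSC _; apply: etrans _ (esym StSC'); apply/funext => l.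
  apply: (congr1 fine).
  exact: (mixedE _ (measurable_itv `]-oo, l[)).
by rewrite /density_eq /st /st2 StCE StSCE; split; exact: aeW.
Qed.
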